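(* Let $\alpha\in(0,1)\cup(1,\infty)$ and let $p_{X,Y}=p_Xp_{Y\mid X}$ be a joint distribution on finite alphabets $\mathcal X\times\mathcal Y$. Then $$I_\alpha^{\mathrm C}(X;Y)=\begin{cases}\min_{\tilde q_{Y\mid X}}\min_{q_Y}F_\alpha^{\mathrm C}(\tilde q_{Y\mid X},q_Y),&\alpha\in(0,1),\\[2pt] \max_{\tilde q_{Y\mid X}}\max_{r_{X\mid Y}}\tilde F_\alpha^{\mathrm C}(\tilde q_{Y\mid X},r_{X\mid Y}),&\alpha\in(1,\infty),\end{cases}$$ and, for all $\alpha\in(0,1)\cup(1,\infty)$, $$I_\alpha^{\mathrm C}(X;Y)=H(p_X)+\max_{r_{X\mid Y}}\frac{\alpha}{\alpha-1}\sum_x p_X(x)\log\sum_y p_{Y\mid X}(y\mid x)\,r_{X\mid Y}(x\mid y)^{1-\frac1\alpha},$$ where $$F_\alpha^{\mathrm C}(\tilde q_{Y\mid X},q_Y):=\frac{\alpha}{1-\alpha}D(p_X\tilde q_{Y\mid X}\|p_Xp_{Y\mid X})+D(p_X\tilde q_{Y\mid X}\|p_Xq_Y),$$ $$\tilde F_\alpha^{\mathrm C}(\tilde q_{Y\mid X},r_{X\mid Y}):=\frac{\alpha}{1-\alpha}D(p_X\tilde q_{Y\mid X}\|p_Xp_{Y\mid X})+\mathbb E^{p_X\tilde q_{Y\mid X}}\!\left[\log\frac{r_{X\mid Y}(X\mid Y)}{p_X(X)}\right].$$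
   Context: All alphabets are finite and $\log$ is natural. $H(p_X)=-\sum_xp_X(x)\log p_X(x)$ is the Shannon entropy and $D(p\|q)=\sum_zp(z)\log\frac{p(z)}{q(z)}$ the Kullback–Leibler divergence. The Rényi divergence of order $\alpha$ is $D_\alpha(p\|q):=\frac{1}{\alpha-1}\log\sum_zp(z)^\alpha q(z)^{1-\alpha}$, and the Augustin–Csiszár mutual information of order $\alpha$ is $I_\alpha^{\mathrm C}(X;Y):=\min_{q_Y}\sum_xp_X(x)D_\alpha(p_{Y\mid X}(\cdot\mid x)\|q_Y)$. Optimizations over $q_Y$ range over distributions on $\mathcal Y$, over $\tilde q_{Y\mid X}$ over all channels (families $\{\tilde q_{Y\mid X}(\cdot\mid x)\}_{x\in\mathcal X}$ of distributions on $\mathcal Y$), and over $r_{X\mid Y}$ over all reverse channels (families $\{r_{X\mid Y}(\cdot\mid y)\}_{y\in\mathcal Y}$ of distributions on $\mathcal X$). $p_X\tilde q_{Y\mid X}$ denotes the joint distribution $p_X(x)\tilde q_{Y\mid X}(y\mid x)$, and $p_Xq_Y$ the product distribution. *)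

(* Defs.v *)
From HB Require Import structures.
From mathcomp Require Import all_boot all_order all_algebra.
From mathcomp Require Import all_classical all_reals.
From mathcomp Require Import ereal exp.
Set Implicit Arguments. Unset Strict Implicit. Unset Printing Implicit Defensive.
Import Order.TTheory GRing.Theory Num.Theory.
Local Open Scope ring_scope.
Local Open Scope ereal_scope.

Section Defs.
Variable R : realType.

Definition is_dist (T : finType) (p : T -> R) : Prop :=
  (forall t, (0 <= p t)%R) /\ (\sum_(t : T) p t)%R = 1%R.

Definition is_channel (A B : finType) (W : A -> B -> R) : Prop :=
  forall a, is_dist (W a).

Definition epowR (r e : R) : \bar R :=
  if r == 0%R then (if (e < 0)%R then +oo else if e == 0%R then 1 else 0)
  else (r `^ e)%:E.

Definition eln (x : \bar R) : \bar R :=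
  match x with
  | x%:E => if x == 0%R then -oo else (ln x)%:E
  | +oo => +oo
  | -oo => -oo
  end.

Definition entropy (T : finType) (p : T -> R) : R :=
  (- \sum_(t : T) (if p t == 0 then 0 else p t * ln (p t)))%R.

Definition kl_term (a b : R) : \bar R :=
  if a == 0%R then 0 else if b == 0%R then +oo else (a * ln (a / b))%:E.
Definition KL (T : finType) (p q : T -> R) : \bar R :=
  \sum_(t : T) kl_term (p t) (q t).

Definition renyi (a : R) (T : finType) (p q : T -> R) : \bar R :=
  ((a - 1)^-1)%:E * eln (\sum_(t : T) epowR (p t) a * epowR (q t) (1 - a)).

Definition AC_obj (a : R) (X Y : finType) (pX : X -> R) (pYX : X -> Y -> R)
  (qY : Y -> R) : \bar R :=
  \sum_(x : X) (pX x)%:E * renyi a (pYX x) qY.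
Definition I_AC (a : R) (X Y : finType) (pX : X -> R) (pYX : X -> Y -> R)
  : \bar R :=
  ereal_inf [set AC_obj a pX pYX qY | qY in [set qY | is_dist qY]]%classic.

Definition joint (X Y : finType) (pX : X -> R) (W : X -> Y -> R) : X * Y -> R :=
  fun z => (pX z.1 * W z.1 z.2)%R.
Definition prodd (X Y : finType) (pX : X -> R) (qY : Y -> R) : X * Y -> R :=
  fun z => (pX z.1 * qY z.2)%R.

Definition F_AC (a : R) (X Y : finType) (pX : X -> R) (pYX : X -> Y -> R)
  (qt : X -> Y -> R) (qY : Y -> R) : \bar R :=
  (a / (1 - a))%:E * KL (joint pX qt) (joint pX pYX)
  + KL (joint pX qt) (prodd pX qY).

(* tilde F_a^C ; expectation of log (r(X|Y)/p_X(X)) under p_X qt,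
   with r : Y -> X -> R the reverse channel r_{X|Y}(x|y) = r y x *)
Definition F_AC_tilde (a : R) (X Y : finType) (pX : X -> R)
  (pYX : X -> Y -> R) (qt : X -> Y -> R) (r : Y -> X -> R) : \bar R :=
  (a / (1 - a))%:E * KL (joint pX qt) (joint pX pYX)
  + \sum_(z : X * Y) (joint pX qt z)%:E * eln ((r z.2 z.1 / pX z.1)%:E).

Definition G_AC (a : R) (X Y : finType) (pX : X -> R) (pYX : X -> Y -> R)
  (r : Y -> X -> R) : \bar R :=
  (a / (a - 1))%:E *
  \sum_(x : X) (pX x)%:E *
     eln (\sum_(y : Y) (pYX x y)%:E * epowR (r y x) (1 - a^-1)).

Definition is_minimum (T : Type) (P : T -> Prop) (f : T -> \bar R) (v : \bar R) :=
  (exists t, P t /\ f t = v) /\ (forall t, P t -> v <= f t).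
Definition is_maximum (T : Type) (P : T -> Prop) (f : T -> \bar R) (v : \bar R) :=
  (exists t, P t /\ f t = v) /\ (forall t, P t -> f t <= v).

End Defs.

(* Main.v *)
Require Import Defs.
From HB Require Import structures.
From mathcomp Require Import all_boot all_order all_algebra.
From mathcomp Require Import all_classical all_reals.
From mathcomp Require Import ereal exp.
From mathcomp Require Import topology normedtype sequences derive.
From mathcomp Require Import ring lra.
Import Order.TTheory GRing.Theory Num.Theory.
Import numFieldTopology.Exports numFieldNormedType.Exports.

(** Write S_x(q) = sum_y p(y|x)^a q(y)^(1-a) and
    T_x(r) = sum_y p(y|x) r(x|y)^(1-1/a).  Hoelder's inequality bounds
    (a/(a-1)) ln T_x(r) by (a-1)^-1 ln S_x(q) + ln (sum_y q(y) r(x|y)), and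
    averaging over p_X with Gibbs' inequality gives weak duality:
    H(p_X) + G(r) <= sum_x p_X(x) D_a(p(.|x) || q) for all q and r.

    Equality holds at a saddle point (q, r), where q(y) r(x|y) = p_X(x) t(y|x)
    with t(y|x) proportional to both p(y|x)^a q(y)^(1-a) and
    p(y|x) r(x|y)^(1-1/a).  To find one, maximize over channels v the product
    of (sum_y A(x,y) v(h(x,y))^th)^(p_X(x)) with 0 < th < 1: for a < 1 take
    A = p^a, th = 1 - a and v = q; for a > 1 take A = p, th = 1 - 1/a and v = r.
    The exponent being positive, this objective is continuous on a compact
    set, and no maximizer vanishes where it matters, since e^th outweighs e for
    small e.  Replacing v by the normalized flow of its tilted channel does not
    decrease the objective, and equality in Gibbs' inequality forces v to be
    a fixed point, which is the saddle point equation.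

    The functionals F and F~ are compared with D_a and G by the log-sum
    inequality, which is tight at the tilted channel t. *)

Set Implicit Arguments. Unset Strict Implicit. Unset Printing Implicit Defensive.
Local Open Scope classical_set_scope.
Local Open Scope ring_scope.

(** * Maximization over channels *)

(** The absolute value matters because [powR] sends every negative base to 1, so the bare power
    jumps at 0. Away from 0 the function is exp(e ln |t|), and at 0 a radius is given explicitly. *)
Lemma continuous_norm_powR (R : realType) (e : R) :
  0 < e -> continuous (fun t : R => `|t| `^ e).
Proof.
move=> e0 t; have [->|t0] := eqVneq t 0.
  (* The radius eps^(1/e) solves s^e = eps. *)
  apply/cvgrPdist_lt => eps eps0; rewrite normr0 powR0 ?gt_eqF//.
  apply/nbhs_normP; exists (eps `^ e^-1); first exact: powR_gt0.
  move=> s /=; rewrite !sub0r !normrN [`|_ `^ _|]ger0_norm ?powR_ge0// => seps.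
  rewrite -[ltRHS](powRr1 (ltW eps0)) -(mulVf (lt0r_neq0 e0)) powRrM.
  by apply: gt0_ltr_powR; rewrite ?nnegrE ?powR_ge0.
have E : `|t| `^ e = expR (e * ln `|t|) by rewrite /powR normr_eq0 (negbTE t0).
rewrite /continuous_at/= E.
apply: (@cvg_trans _ ((fun s : R => expR (e * ln `|s|)) @ nbhs t)).
  apply: near_eq_cvg.
  have : \forall s \near t, s != 0 by apply: open_nbhs_nbhs; split; first exact: open_neq.
  by apply: filterS => s s0; rewrite /powR normr_eq0 (negbTE s0).
apply: continuous_cvg; first exact: continuous_expR.
apply: cvgM; [exact: cvg_cst|apply: continuous_cvg].
  by apply: continuous_ln; rewrite normr_gt0.
exact: norm_continuous.
Qed.

(** Channels are uncurried to points of a product of lines: the cube [0,1]^(B x C) is compact by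
    Tychonoff, and the row sum conditions cut out a closed subset. *)
Lemma compact_channels (R : realType) (B C : finType) :
  compact ([set v | is_channel (fun b c => v (b, c))]
           : set (prod_topology (fun _ : B * C => R))).
Proof.
pose cube : set (prod_topology (fun _ : B * C => R)) :=
  [set v | forall z, [set` `[0, 1]] (v z)].
have cubeC : compact cube.
  have := @tychonoff (B * C)%type (fun _ => R) (fun _ => [set` `[0, 1]]).
  by apply=> z; exact: segment_compact.
pose aff b : set (prod_topology (fun _ : B * C => R)) :=
  [set v | \sum_c v (b, c) = 1].
have affC : closed (\bigcap_b aff b).
  apply: closed_bigI => b _.
  apply: (@preimage_closed _ R
    (fun v : prod_topology (fun _ : B * C => R) => \sum_c v (b, c))
    [set x | x = 1]); last exact: closed_eq.
  move=> v _; apply: continuous_big; first exact: add_continuous.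
  by move=> c _; exact: (@proj_continuous _ (fun _ => R) (b, c)).
rewrite (_ : [set _ | _] = cube `&` \bigcap_b aff b).
  exact: compact_closedI.
apply/seteqP; split => v.
  move=> vch; split=> [[b c]|b _]; last by have [] := vch b.
  have [v0 v1] := vch b.
  by rewrite /= in_itv/= v0/= -v1 (bigD1 c)//= lerDl sumr_ge0.
move=> [vcube vaff] b; split; last exact: (vaff b).
by move=> c; have := vcube (b, c); rewrite /= in_itv => /andP[].
Qed.

(* The index map h selects which entry of the channel v weights the pair (x, y);
   it lets v be either an output distribution (B = unit, C = Y) or a reverse
   channel (B = Y, C = X). *)
Definition tilted_sum {R : realType} {X Y B C : finType} (th : R)
    (A : X -> Y -> R) (h : X -> Y -> B * C) (v : B -> C -> R) (x : X) : R :=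
  \sum_y A x y * v (h x y).1 (h x y).2 `^ th.

Lemma invr_card_gt0 (R : realType) (C : finType) (c : C) : 0 < #|C|%:R^-1 :> R.
Proof. by rewrite invr_gt0 ltr0n; apply/card_gt0P; exists c. Qed.

Lemma uniform_channel (R : realType) (B C : finType) (c0 : C) :
  is_channel (fun (_ : B) (_ : C) => #|C|%:R^-1 : R).
Proof.
move=> b; split=> [c|]; first by rewrite invr_ge0.
rewrite sumr_const -[LHS]mulr_natr mulVf// -invr_eq0.
by rewrite gt_eqF// invr_card_gt0.
Qed.

Lemma continuous_tilted_product (R : realType) (T : topologicalType)
    (X Y : finType) (th : R) (w : X -> R) (A : X -> Y -> R)
    (f : X -> Y -> T -> R) :
  0 < th -> (forall x, 0 <= w x) -> (forall x y, continuous (f x y)) ->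
  continuous (fun v : T =>
    \prod_x `|\sum_y A x y * `|f x y v| `^ th| `^ w x).
Proof.
move=> th0 w0 fC; apply: (@continuous_big R X *%R 1 xpredT _ T).
  exact: mul_continuous.
(* A zero weight makes the factor constantly 1, even where its base vanishes; [continuous_norm_powR]
   covers only positive exponents. *)
move=> x _; have := w0 x; rewrite le_eqVlt => /predU1P[<-|wx0].
  have -> : (fun v : T => `|\sum_y A x y * `|f x y v| `^ th| `^ 0) = cst 1.
    by apply/funext => v; rewrite powRr0.
  exact: cst_continuous.
move=> v; apply: (@continuous_comp T R R (fun v => \sum_y A x y * `|f x y v| `^ th)
  (fun t : R => `|t| `^ w x)); last exact: continuous_norm_powR.
apply: (@continuous_big R Y +%R 0 xpredT _ T); first exact: add_continuous.
move=> y _ {}v; apply: cvgM; first exact: cvg_cst.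
apply: (@continuous_comp T R R (f x y) (fun t : R => `|t| `^ th)); first exact: fC.
exact: continuous_norm_powR.
Qed.

(** The extreme value theorem on the compact set of channels. The product of powers stays finite and
    continuous where a tilted sum vanishes, unlike the sum of logarithms. *)
Lemma exists_max_channel (R : realType) (X Y B C : finType) (th : R)
    (w : X -> R) (A : X -> Y -> R) (h : X -> Y -> B * C) :
  0 < th -> (forall x, 0 <= w x) -> (forall x y, 0 <= A x y) ->
  (exists v : B -> C -> R, is_channel v) ->
  exists2 v : B -> C -> R, is_channel v & forall u, is_channel u ->
    \prod_x tilted_sum th A h u x `^ w x <= \prod_x tilted_sum th A h v x `^ w x.
Proof.
move=> th0 w0 A0 [u0 u0ch].
(* Absolute values make the objective continuous on the whole space. *)
have phiE (u : B * C -> R) : (forall z, 0 <= u z) ->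
    \prod_x `|\sum_y A x y * `|u (h x y)| `^ th| `^ w x =
    \prod_x tilted_sum th A h (fun b c => u (b, c)) x `^ w x.
  move=> u0'; apply: eq_bigr => x _; congr (_ `^ _).
  rewrite ger0_norm; last by apply: sumr_ge0 => y _; rewrite mulr_ge0 ?powR_ge0.
  by apply: eq_bigr => y _; rewrite ger0_norm// -surjective_pairing.
have phiC := @continuous_tilted_product R (prod_topology (fun _ : B * C => R))
  X Y th w A (fun x y v => v (h x y)) th0 w0
  (fun x y => @proj_continuous _ (fun _ => R) (h x y)).
have [|v /set_mem vch vmax] := @compact_EVT_max _ R _ _ _ (@compact_channels R B C)
  (continuous_subspaceT phiC).
  by exists (fun z => u0 z.1 z.2).
have nn (t : B * C -> R) : is_channel (fun b c => t (b, c)) -> forall z, 0 <= t z.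
  by move=> tch [b c]; have [] := tch b.
exists (fun b c => v (b, c)) => [|u uch]; first exact: vch.
have E : \prod_x `|\sum_y A x y * `|u (h x y).1 (h x y).2| `^ th| `^ w x =
    \prod_x tilted_sum th A h u x `^ w x.
  exact: (phiE (fun z => u z.1 z.2) (nn (fun z => u z.1 z.2) uch)).
move: (vmax (fun z => u z.1 z.2) (mem_set uch)).
by congr (is_true (_ <= _)); [exact: E|exact: (phiE v (nn v vch))].
Qed.

(** * Entropy inequalities *)

Lemma ln_leB1 (R : realType) (x : R) : 0 < x -> ln x <= x - 1.
Proof. by move=> x0; have := @le_ln1Dx R (x - 1); rewrite subrKC; apply; lra. Qed.

Lemma ln_eqB1 (R : realType) (x : R) : 0 < x -> ln x = x - 1 -> x = 1.
Proof.
move=> x0 E; apply/eqP/negPn/negP => x1.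
have := @expR_gt1Dx R (x - 1); rewrite subr_eq0 => /(_ x1).
by rewrite -E lnK// E subrKC ltxx.
Qed.

Lemma is_dist_gt0 (R : realType) (T : finType) (p : T -> R) :
  is_dist p -> exists t, 0 < p t.
Proof.
move=> [p0 p1]; apply/not_existsP => pN.
have : \sum_t p t <= 0 by apply: sumr_le0 => t _; rewrite leNgt; apply/negP/pN.
by rewrite p1 ler10.
Qed.

Lemma sumr_gt0_witness (R : realType) (T : finType) (c : T -> R) t :
  (forall t, 0 <= c t) -> 0 < c t -> 0 < \sum_t c t.
Proof.
by move=> c0 ct; rewrite (bigD1 t)//=; apply: ltr_wpDr => //; exact: sumr_ge0.
Qed.

(** Jensen's inequality for the logarithm, obtained termwise from ln s <= s - 1 at s = c / (p C)
    with C the total of [c]. When C = 1 it is Gibbs' inequality. *)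
Lemma log_sum_le (R : realType) (T : finType) (p c : T -> R) :
  is_dist p -> (forall t, 0 <= c t) -> (forall t, 0 < p t -> 0 < c t) ->
  \sum_t p t * ln (c t / p t) <= ln (\sum_t c t).
Proof.
move=> pd c0 pc; have [t pt] := is_dist_gt0 pd; have [p0 p1] := pd.
have C0 : 0 < \sum_t c t by apply: (sumr_gt0_witness (t := t)) => //; exact: pc.
set C := \sum_t c t in C0 *.
rewrite -subr_le0 -[X in _ - X]mul1r -p1 mulr_suml -sumrB.
apply: (@le_trans _ _ (\sum_t (c t / C - p t))); last first.
  by rewrite sumrB -mulr_suml p1 mulfV ?subrr ?gt_eqF.
apply: ler_sum => s _; have := p0 s; rewrite le_eqVlt => /predU1P[<-|ps].
  by rewrite !mul0r !subr0 divr_ge0// ltW.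
have cs := pc _ ps.
rewrite -mulrBr -ln_div ?posrE ?divr_gt0//.
have := @ln_leB1 R (c s / p s / C); rewrite !divr_gt0// => /(_ isT).
move/(ler_wpM2l (p0 s))/le_trans; apply.
by rewrite le_eqVlt; apply/orP; left; apply/eqP; field; rewrite !gt_eqF.
Qed.

Lemma log_sum_eq (R : realType) (T : finType) (p c : T -> R) (C : R) :
  0 < C -> is_dist p -> (forall t, p t = c t / C) ->
  \sum_t p t * ln (c t / p t) = ln C.
Proof.
move=> C0 [p0 p1] pE; rewrite -[RHS]mul1r -p1 mulr_suml; apply: eq_bigr => t _.
have [->|pt] := eqVneq (p t) 0; first by rewrite !mul0r.
congr (_ * ln _); move: pt; rewrite pE => pt.
have ct : c t != 0 by apply: contra pt => /eqP ->; rewrite mul0r.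
by field; rewrite ct gt_eqF.
Qed.

(** Hoelder's inequality in logarithmic form. The log-sum inequality is applied to [u] and to [v]
    with the same weights p = z / Z; for [z] itself these weights give equality. *)
Lemma ln_holder (R : realType) (T : finType) (l : R) (u v z : T -> R) :
  0 < l < 1 -> (forall t, 0 <= u t) -> (forall t, 0 <= v t) ->
  (forall t, z t = u t `^ l * v t `^ (1 - l)) -> 0 < \sum_t z t ->
  ln (\sum_t z t) <= l * ln (\sum_t u t) + (1 - l) * ln (\sum_t v t).
Proof.
move=> /andP[l0 l1] u0 v0 zE; set Z := \sum_t z t => Z0.
have z0 t : 0 <= z t by rewrite zE mulr_ge0 ?powR_ge0.
pose p t := z t / Z.
have pd : is_dist p.
  by split=> [t|]; rewrite ?divr_ge0 ?(ltW Z0)// -mulr_suml mulfV ?gt_eqF.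
have pz t : 0 < p t -> 0 < z t by rewrite /p pmulr_lgt0 ?invr_gt0.
have pu t : 0 < p t -> 0 < u t.
  move/pz; rewrite zE => z1; rewrite lt0r (u0 t) andbT; apply/eqP => ut; move: z1.
  by rewrite ut powR0 ?mul0r ?ltxx// gt_eqF.
have pv t : 0 < p t -> 0 < v t.
  move/pz; rewrite zE => z1; rewrite lt0r (v0 t) andbT; apply/eqP => vt; move: z1.
  by rewrite vt powR0 ?mulr0 ?ltxx// gt_eqF// subr_gt0.
have := lerD (ler_wpM2l (ltW l0) (log_sum_le pd u0 pu))
  (ler_wpM2l (_ : 0 <= 1 - l) (log_sum_le pd v0 pv)).
rewrite subr_ge0 (ltW l1) => /(_ isT); apply: le_trans.
rewrite -(log_sum_eq (p := p) (c := z))// !mulr_sumr -big_split/= ler_sum// => t _.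
have := pd.1 t; rewrite le_eqVlt => /predU1P[<-|pt]; first by rewrite !mul0r !mulr0 addr0.
have zt := pz _ pt; have ut := pu _ pt; have vt := pv _ pt.
rewrite !ln_div ?posrE// zE lnM ?posrE ?powR_gt0// !ln_powR.
by rewrite le_eqVlt; apply/orP; left; apply/eqP; ring.
Qed.

(** * Fixed points of the tilting map *)

(** Net change of the objective when a fraction [e] of a channel is moved to the uniform one: every
    row loses at most th ln (1 - e) in logarithm, while a row of weight [m] with a vanishing entry
    gains at least ln (1 + c e^th). Since th < 1, the gain wins for small [e]. *)
Lemma small_perturbation (R : realType) (th c m : R) :
  0 < th < 1 -> 0 < c -> 0 < m ->
  exists2 e, 0 < e < 1 & 0 < th * ln (1 - e) + m * ln (1 + c * e `^ th).
Proof.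
move=> /andP[th0 th1] c0 m0.
(* With s = e^th <= 1 the gain is at least m c s / (1 + c) = 4 K s, and the loss is at most 2 th e;
   hence e <= K s suffices. *)
pose K := m * c / (4 * (1 + c)).
have K0 : 0 < K by rewrite divr_gt0 ?mulr_gt0//; lra.
pose d := Num.min K (2^-1).
have d0 : 0 < d by rewrite lt_min K0 invr_gt0 ltr0n.
have dK : d <= K by rewrite ge_min lexx.
have d12 : d <= 2^-1 by rewrite ge_min lexx orbT.
(* This exponent makes e = d e^th, so that the loss is compared with d <= K. *)
pose e := d `^ (1 - th)^-1.
have e0 : 0 < e by exact: powR_gt0.
have th'0 : 0 < 1 - th by lra.
have ed : e <= d.
  apply: ge1r_powR; first by rewrite d0/=; lra.
  by rewrite invf_ge1 //; lra.
have e12 : e <= 2^-1 by exact: le_trans ed d12.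
have eE : e = d * e `^ th.
  rewrite -(_ : e `^ (1 - th) = d); last first.
    by rewrite -powRrM mulVf ?gt_eqF// powRr1// ltW.
  by rewrite -powRD ?subrK ?powRr1 ?ltW// oner_eq0.
exists e; first by apply/andP; split; lra.
set s := e `^ th in eE *.
have s0 : 0 < s by exact: powR_gt0.
have s1 : s <= 1.
  have := @ger_powR R e _ 0 th (ltW th0); rewrite powRr0; apply.
  by rewrite e0/=; lra.
have le1 : - (2 * e) <= ln (1 - e).
  have e1 : 0 < 1 - e by lra.
  rewrite -[ln _]opprK -lnV ?posrE// lerN2.
  apply: (le_trans (ln_leB1 _)); first by rewrite invr_gt0.
  rewrite lerBlDr -(ler_pM2r e1) mulVf ?gt_eqF//.
  nra.
have cs0 : 0 < 1 + c * s by rewrite addr_gt0// mulr_gt0.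
have le2 : c * s / (1 + c) <= ln (1 + c * s).
  have : c * s / (1 + c) <= 1 - (1 + c * s)^-1.
    have -> : 1 - (1 + c * s)^-1 = c * s / (1 + c * s) by field; rewrite gt_eqF.
    apply: ler_wpM2l; first by rewrite mulr_ge0 ?ltW.
    by rewrite lef_pV2 ?posrE//; nra.
  move/le_trans; apply.
  rewrite -[ln _]opprK -lnV ?posrE//.
  have := @ln_leB1 R (1 + c * s)^-1; rewrite invr_gt0 => /(_ cs0); lra.
have A1 := ler_wpM2l (ltW th0) le1.
have A2 := ler_wpM2l (ltW m0) le2.
apply: lt_le_trans (lerD A1 A2).
have -> : m * (c * s / (1 + c)) = 4 * K * s by rewrite /K; field; lra.
nra.
Qed.

Section FixedPoint.
Context {R : realType} {X Y B C : finType}.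
Variables (th : R) (w : X -> R) (A : X -> Y -> R) (h : X -> Y -> B * C) (c0 : C).
Hypothesis th01 : 0 < th < 1.
Hypothesis wd : is_dist w.
Hypothesis A0 : forall x y, 0 <= A x y.
Hypothesis Apos : forall x, 0 < w x -> exists y, 0 < A x y.

Local Notation S := (tilted_sum th A h).

Let w0 : forall x, 0 <= w x := wd.1.
Let th0 : 0 < th. Proof. by case/andP: th01. Qed.

Lemma tilted_sum_ge0 v x : 0 <= S v x.
Proof. by apply: sumr_ge0 => y _; rewrite mulr_ge0 ?powR_ge0. Qed.

Lemma tilted_sum_gt0 v x y :
  0 < A x y -> 0 < v (h x y).1 (h x y).2 -> 0 < S v x.
Proof.
move=> Axy vxy; apply: (sumr_gt0_witness (t := y)) => [t|].
  by rewrite mulr_ge0 ?powR_ge0.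
by rewrite mulr_gt0 ?powR_gt0.
Qed.

(** The uniform channel gives the product a positive value, so no factor of positive weight vanishes
    at a maximizer. The product is then the exponential of the sum of logarithms. *)
Lemma exists_max_log_channel :
  exists2 v : B -> C -> R,
    is_channel v /\ (forall x, 0 < w x -> 0 < S v x) &
    forall u, is_channel u -> (forall x, 0 < w x -> 0 < S u x) ->
      \sum_x w x * ln (S u x) <= \sum_x w x * ln (S v x).
Proof.
have uniC := @uniform_channel R B C c0.
have [v vch vmax] := @exists_max_channel R X Y B C th w A h th0 w0 A0
  (ex_intro _ _ uniC).
have prodE u : (forall x, 0 < w x -> 0 < S u x) ->
    \prod_x S u x `^ w x = expR (\sum_x w x * ln (S u x)).
  move=> Su; rewrite expR_sum; apply: eq_bigr => x _.
  have := w0 x; rewrite le_eqVlt => /predU1P[<-|/Su Sx].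
    by rewrite powRr0 mul0r expR0.
  by rewrite /powR gt_eqF.
have uniS x : 0 < w x -> 0 < S (fun _ _ => #|C|%:R^-1) x.
  by move=> /Apos[y Axy]; apply: (tilted_sum_gt0 Axy); exact: invr_card_gt0.
have vS x : 0 < w x -> 0 < S v x.
  move=> wx; rewrite lt0r tilted_sum_ge0 andbT; apply/eqP => Sx.
  have := vmax _ uniC; rewrite [leLHS](prodE _ uniS) leNgt => /negP; apply.
  by rewrite (bigD1 x)//= Sx powR0 ?gt_eqF// mul0r expR_gt0.
exists v => // u uch uS.
by rewrite -ler_expR -(prodE _ uS) -(prodE _ vS); exact: vmax.
Qed.

Definition tilted_channel (v : B -> C -> R) (x : X) (y : Y) : R :=
  A x y * v (h x y).1 (h x y).2 `^ th / S v x.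

(** The image under [h] of the joint law with input [w] and channel [tilted_channel v]. *)
Definition tilted_flow (v : B -> C -> R) (b : B) (c : C) : R :=
  \sum_x \sum_(y | h x y == (b, c)) w x * tilted_channel v x y.

Lemma sum_tilted_flow v (g : B -> C -> R) :
  \sum_b \sum_c tilted_flow v b c * g b c =
  \sum_x w x * \sum_y tilted_channel v x y * g (h x y).1 (h x y).2.
Proof.
rewrite pair_bigA/=.
under eq_bigr do rewrite /tilted_flow mulr_suml.
rewrite exchange_big; apply: eq_bigr => x _ /=.
under eq_bigr do rewrite mulr_suml.
rewrite (exchange_big_dep xpredT)//= mulr_sumr; apply: eq_bigr => y _.
by rewrite (big_pred1 (h x y)) ?mulrA// => z; rewrite /= eq_sym -surjective_pairing.
Qed.

Lemma tilted_channel_is_dist v x : 0 < S v x -> is_dist (tilted_channel v x).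
Proof.
move=> Sx; split=> [y|]; first by rewrite divr_ge0 ?mulr_ge0 ?powR_ge0// ltW.
by rewrite -mulr_suml mulfV ?gt_eqF.
Qed.

Section Maximizer.
Variable v : B -> C -> R.
Hypothesis vch : is_channel v.
Hypothesis Sv : forall x, 0 < w x -> 0 < S v x.
Hypothesis vmax : forall u, is_channel u -> (forall x, 0 < w x -> 0 < S u x) ->
  \sum_x w x * ln (S u x) <= \sum_x w x * ln (S v x).

Let v0 b c : 0 <= v b c. Proof. by have [] := vch b. Qed.

(** If this entry vanished, mixing [v] with the uniform channel would increase the objective, by
    [small_perturbation]. *)
Lemma maximizer_gt0 x y : 0 < w x -> 0 < A x y -> 0 < v (h x y).1 (h x y).2.
Proof.
move=> wx Axy; rewrite lt0r v0 andbT; apply/eqP => vxy.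
pose k : R := #|C|%:R^-1.
have k0 : 0 < k by exact: invr_card_gt0.
(* The term at [y], absent from the sum for [v], becomes A(x,y) (k e)^th after mixing; [c] is its
   size relative to [S v x], without the factor e^th. *)
pose c := A x y * k `^ th / S v x.
have c_gt0 : 0 < c by rewrite divr_gt0 ?mulr_gt0 ?powR_gt0 ?Sv.
have [e /andP[e0 e1] gain] := small_perturbation th01 c_gt0 wx.
have e1' : 0 < 1 - e by rewrite subr_gt0.
pose u b d := (1 - e) * v b d + e * k.
have uv b d : (1 - e) * v b d <= u b d by rewrite lerDl mulr_ge0 ?ltW.
have uch : is_channel u.
  move=> b; split=> [d|]; first by rewrite addr_ge0 ?mulr_ge0 ?(ltW e1') ?(ltW e0) ?(ltW k0).
  rewrite big_split/= -!mulr_sumr (vch b).2.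
  by rewrite (@uniform_channel R B C c0 b).2 !mulr1 subrK.
have termS a t : (1 - e) `^ th * (A a t * v (h a t).1 (h a t).2 `^ th) <=
    A a t * u (h a t).1 (h a t).2 `^ th.
  rewrite mulrCA -powRM ?(ltW e1')//; apply: ler_wpM2l => //.
  apply: ge0_ler_powR; rewrite ?nnegrE ?(ltW th0) ?mulr_ge0 ?(ltW e1')//.
  exact: (uch _).1.
have S_le a : (1 - e) `^ th * S v a <= S u a.
  by rewrite mulr_sumr; apply: ler_sum => t _; exact: termS.
have p0 : 0 < (1 - e) `^ th by exact: powR_gt0.
have Su a : 0 < w a -> 0 < S u a.
  by move=> wa; apply: lt_le_trans (S_le a); rewrite mulr_gt0 ?Sv.
have Sx : (1 - e) `^ th * (S v x * (1 + c * e `^ th)) <= S u x.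
  rewrite mulrDr mulr1 mulrDr.
  have -> : S v x * (c * e `^ th) = A x y * (k * e) `^ th.
    by rewrite /c powRM ?ltW//; field; rewrite gt_eqF ?Sv.
  rewrite [S v x](bigD1 y)//= vxy powR0 ?gt_eqF// mulr0 add0r [S u x](bigD1 y)//=.
  rewrite mulr_sumr addrC; apply: lerD.
    by apply: ler_sum => t _; exact: termS.
  rewrite /u vxy mulr0 add0r (mulrC e k) -[leRHS]mul1r.
  apply: ler_wpM2r; first by rewrite mulr_ge0 ?powR_ge0.
  rewrite -[leRHS](_ : 1 `^ th = 1); last by rewrite powR1.
  apply: ge0_ler_powR; [exact: ltW|by rewrite nnegrE ltW|by rewrite nnegrE|].
  by rewrite gerBl ltW.
have := vmax uch Su; rewrite leNgt => /negP; apply.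
set q := 1 + c * e `^ th in gain Sx; set l := ln q in gain.
have q0 : 0 < q by rewrite addr_gt0// mulr_gt0// powR_gt0.
(* The gain is distributed over the rows: th ln (1 - e) to each, as [w] sums to 1, and [l] to row
   [x] alone. *)
have -> : \sum_a w a * ln (S v a) = \sum_a w a *
    (ln (S v a) + th * ln (1 - e) + (a == x)%:R * l) - (th * ln (1 - e) + w x * l).
  under [in RHS]eq_bigr do rewrite !mulrDr.
  rewrite !big_split/= -mulr_suml wd.2 mul1r [X in _ + _ + X](bigD1 x)//= eqxx.
  rewrite [X in _ + (_ + X)]big1 => [|a /negbTE ->]; last by rewrite mul0r mulr0.
  by rewrite mul1r; ring.
rewrite ltrBlDr; apply: (le_lt_trans _ (ltr_pwDr gain (lexx _))).
apply: ler_sum => a _; have := w0 a; rewrite le_eqVlt => /predU1P[<-|wa].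
  by rewrite !mul0r.
apply: ler_wpM2l; first exact: ltW.
have [ax|ax] := eqVneq a x.
  have -> : ln (S v a) + th * ln (1 - e) + 1 * l =
      ln ((1 - e) `^ th * (S v x * q)).
    by rewrite ax !lnM ?posrE ?mulr_gt0 ?Sv// ln_powR /l; ring.
  by rewrite ax ler_ln ?posrE ?Su// !mulr_gt0 ?Sv.
have -> : ln (S v a) + th * ln (1 - e) + 0 * l = ln ((1 - e) `^ th * S v a).
  by rewrite lnM ?posrE ?Sv// ln_powR; ring.
by rewrite ler_ln ?posrE ?Su// mulr_gt0 ?Sv.
Qed.
(** Let [u] be the row-normalized flow M. Maximality of [v] and the log-sum inequality give sum M ln
    (u/v) <= 0. The tangent bound on the logarithm gives the opposite inequality, term by term after
    subtracting quantities of total 0. So every term is tight, which forces u = v wherever the flow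
    is positive. *)
Lemma maximizer_fixed_point b c :
  tilted_flow v b c = v b c * \sum_d tilted_flow v b d.
Proof.
pose M := tilted_flow v; pose N b := \sum_d M b d.
have tc0 x y : 0 < w x -> 0 <= tilted_channel v x y.
  by move=> /Sv /tilted_channel_is_dist[].
have wt0 x y : 0 <= w x * tilted_channel v x y.
  have := w0 x; rewrite le_eqVlt => /predU1P[<-|wx]; first by rewrite mul0r.
  by rewrite mulr_ge0 ?tc0.
have M0 a d : 0 <= M a d by apply: sumr_ge0 => x _; exact: sumr_ge0.
have N0 a : 0 <= N a by exact: sumr_ge0.
have M_gt0 x y : 0 < w x -> 0 < A x y -> 0 < M (h x y).1 (h x y).2.
  move=> wx Axy; rewrite /M /tilted_flow (bigD1 x)//= (bigD1 y)/=; last first.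
    by rewrite -surjective_pairing.
  do 2 (apply: ltr_wpDr; first by do ?[apply: sumr_ge0 => ? _]).
  by rewrite mulr_gt0// divr_gt0 ?Sv// mulr_gt0 ?powR_gt0// maximizer_gt0.
have v_gt0 a d : 0 < M a d -> 0 < v a d.
  rewrite !lt0r v0 andbT => /andP[+ _]; apply: contra => /eqP vad.
  apply/eqP/big1 => x _; apply: big1 => y /eqP hxy.
  by rewrite /tilted_channel hxy/= vad powR0 ?gt_eqF// mulr0 mul0r mulr0.
(* A row without flow cannot be normalized and keeps its value from [v]. *)
pose u a d := if N a == 0 then v a d else M a d / N a.
have uch : is_channel u.
  move=> a; rewrite /u; case: eqVneq => // Na; split=> [d|].
    by rewrite divr_ge0.
  by rewrite -mulr_suml mulfV.
have MN a d : M a d = u a d * N a.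
  rewrite /u; case: eqVneq => [Na|Na]; last by rewrite divfK.
  by rewrite Na mulr0; apply: (psumr_eq0P _ Na).
have u_gt0 a d : 0 < M a d -> 0 < u a d.
  move=> Mad; rewrite lt0r (uch a).1 andbT; apply/eqP => uad.
  by move: Mad; rewrite MN uad mul0r ltxx.
have Su x : 0 < w x -> 0 < S u x.
  by move=> wx; have [y Axy] := Apos wx; apply: (tilted_sum_gt0 Axy); rewrite ?u_gt0 ?M_gt0.
(* By the log-sum inequality with the tilted channel as weights, [th] times this sum bounds from
   below the increase of the objective from [v] to [u]. *)
have le0 : \sum_a \sum_d M a d * ln (u a d / v a d) <= 0.
  rewrite sum_tilted_flow -(pmulr_rle0 _ th0) mulr_sumr.
  rewrite -[leRHS](subrr (\sum_x w x * ln (S v x))).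
  apply: le_trans (lerB (vmax uch Su) (lexx _)); rewrite -sumrB.
  apply: ler_sum => x _; rewrite -mulrBr mulrCA.
  have := w0 x; rewrite le_eqVlt => /predU1P[<-|wx]; first by rewrite !mul0r.
  apply: ler_wpM2l => //; rewrite lerBrDr.
  have td := tilted_channel_is_dist (Sv wx).
  have tA y : 0 < tilted_channel v x y -> 0 < A x y.
    rewrite [0 < A x y]lt0r A0 andbT => ty; apply/eqP => Axy.
    by move: ty; rewrite /tilted_channel Axy !mul0r ltxx.
  apply: le_trans (log_sum_le (c := fun y => A x y * u (h x y).1 (h x y).2 `^ th) td _ _).
  - rewrite -[X in _ + X]mul1r -td.2 mulr_suml mulr_sumr -big_split/=.
    apply: ler_sum => y _; have := td.1 y.
    rewrite le_eqVlt => /predU1P[<-|ty]; first by rewrite !mul0r mulr0 addr0.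
    have Axy := tA _ ty; have vxy := maximizer_gt0 wx Axy.
    have uxy := u_gt0 _ _ (M_gt0 _ _ wx Axy).
    have -> : ln (A x y * u (h x y).1 (h x y).2 `^ th / tilted_channel v x y) =
        ln (S v x) + (th * ln (u (h x y).1 (h x y).2) - th * ln (v (h x y).1 (h x y).2)).
      rewrite -!ln_powR -ln_div ?posrE ?powR_gt0// -lnM ?posrE ?Sv ?divr_gt0 ?powR_gt0//.
      by congr ln; rewrite /tilted_channel; field; rewrite !gt_eqF ?powR_gt0 ?Sv.
    by rewrite ln_div ?posrE// le_eqVlt; apply/orP; left; apply/eqP; ring.
  - by move=> y; rewrite mulr_ge0 ?powR_ge0.
  - by move=> y /tA Axy; rewrite mulr_gt0 ?powR_gt0// u_gt0// M_gt0.
have term_ge a d : M a d - v a d * N a <= M a d * ln (u a d / v a d).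
  have := M0 a d; rewrite le_eqVlt => /predU1P[<-|Mad].
    by rewrite mul0r sub0r oppr_le0 mulr_ge0.
  have [vad uad] := (v_gt0 _ _ Mad, u_gt0 _ _ Mad).
  have Na : 0 < N a by move: Mad; rewrite MN pmulr_rgt0.
  have -> : M a d - v a d * N a = M a d * - (v a d / u a d - 1).
    by rewrite MN; field; rewrite gt_eqF.
  apply: ler_wpM2l => //; rewrite -[u a d / _]invf_div lnV ?posrE ?divr_gt0// lerN2.
  by rewrite ln_leB1 ?divr_gt0.
have sum0 : \sum_a \sum_d (M a d - v a d * N a) = 0.
  apply: big1 => a _; rewrite sumrB -mulr_suml (vch a).2 mul1r.
  by rewrite -/(N a) subrr.
have tight a d : M a d * ln (u a d / v a d) = M a d - v a d * N a.
  apply/eqP; rewrite -subr_eq0; apply/eqP.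
  have g0 a' d' : 0 <= M a' d' * ln (u a' d' / v a' d') - (M a' d' - v a' d' * N a').
    by rewrite subr_ge0.
  have gs : \sum_a' \sum_d' (M a' d' * ln (u a' d' / v a' d') - (M a' d' - v a' d' * N a')) = 0.
    apply/eqP; rewrite eq_le sumr_ge0 => [|? _]; last exact: sumr_ge0.
    by under eq_bigr do rewrite sumrB; rewrite sumrB sum0 subr0 le0.
  have /(_ a isT) ga := psumr_eq0P (fun a' _ => sumr_ge0 _ (fun d' _ => g0 a' d')) gs.
  exact: (psumr_eq0P (fun d' _ => g0 a d') ga).
(* Where the flow vanishes, tightness reads 0 = - v N, which is already the claim. *)
have := M0 b c; rewrite -/M -/(N b) le_eqVlt => /predU1P[M0bc|Mbc].
  by have := tight b c; rewrite -M0bc mul0r sub0r => /eqP; rewrite eq_sym oppr_eq0 => /eqP.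
have [vbc ubc] := (v_gt0 _ _ Mbc, u_gt0 _ _ Mbc).
have uv1 : v b c / u b c = 1.
  apply: ln_eqB1; first exact: divr_gt0.
  apply: (mulfI (lt0r_neq0 Mbc)); have := tight b c.
  rewrite -[u b c / _]invf_div lnV ?posrE ?divr_gt0// mulrN => /eqP.
  rewrite eqr_oppLR => /eqP ->.
  by rewrite MN; field; rewrite gt_eqF.
by rewrite (divr1_eq uv1); exact: MN.
Qed.

End Maximizer.
End FixedPoint.

(** * Saddle points *)

(* For fixed x, [saddle_k_eq] says that p(y|x) is proportional to
   q(y) r(x|y)^(1/a), with constant k(x); [saddle_flow] makes r the posterior of
   the joint distribution p_X t, whose second marginal is q. *)
Record saddle_point {R : realType} {X Y : finType} (a : R) (pX : X -> R)
    (p : X -> Y -> R) (q : Y -> R) (r : Y -> X -> R) (t : X -> Y -> R)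
    (k : X -> R) : Prop := SaddlePoint {
  saddle_q : is_dist q;
  saddle_r : is_channel r;
  saddle_t : forall x, 0 < pX x -> is_dist (t x);
  saddle_k : forall x, 0 < pX x -> 0 < k x;
  saddle_t0 : forall x y, 0 < pX x -> p x y = 0 -> t x y = 0;
  saddle_pos : forall x y, 0 < pX x -> 0 < p x y -> 0 < q y /\ 0 < r y x;
  saddle_flow : forall x y, 0 < pX x -> 0 < p x y ->
    q y * r y x = pX x * t x y;
  saddle_k_eq : forall x y, 0 < pX x -> 0 < p x y ->
    p x y * k x = q y * r y x `^ a^-1 }.

Section Saddle.
Context {R : realType} {X Y : finType}.
Variables (a : R) (pX : X -> R) (p : X -> Y -> R).
Hypothesis a0 : 0 < a.
Hypothesis pXd : is_dist pX.
Hypothesis pch : is_channel p.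

Let pX0 x : 0 <= pX x. Proof. exact: pXd.1. Qed.
Let p0 x y : 0 <= p x y. Proof. exact: (pch x).1. Qed.

(** With B = unit the channel is a single distribution q. The fixed point equation says that q is
    the output marginal of p_X t, and r is then defined by Bayes' rule. *)
Lemma exists_saddle_point_lt1 : a < 1 -> exists q r t k, saddle_point a pX p q r t k.
Proof.
move=> a1.
have [x0 _] := is_dist_gt0 pXd; have [y0 _] := is_dist_gt0 (pch x0).
pose A x y := p x y `^ a; pose h (x : X) (y : Y) := (tt, y).
have th01 : 0 < 1 - a < 1 by rewrite subr_gt0 a1 gtrBl a0.
have A0 x y : 0 <= A x y by exact: powR_ge0.
have Apos x : 0 < pX x -> exists y, 0 < A x y.
  by move=> _; have [y py] := is_dist_gt0 (pch x); exists y; exact: powR_gt0.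
have [v [vch Sv] vmax] := exists_max_log_channel h y0 th01 pXd A0 Apos.
pose q y := v tt y; pose S := tilted_sum (1 - a) A h v.
pose t := tilted_channel (1 - a) A h v.
have td x : 0 < pX x -> is_dist (t x).
  by move=> px; exact: (tilted_channel_is_dist A0 (Sv x px)).
have q0 x y : 0 < pX x -> 0 < p x y -> 0 < q y.
  move=> px pxy.
  by have := maximizer_gt0 y0 th01 pXd A0 vch Sv vmax px (powR_gt0 a pxy).
have flowE y : tilted_flow (1 - a) pX A h v tt y = \sum_x pX x * t x y.
  by apply: eq_bigr => x _; rewrite (big_pred1 y)// => y'; rewrite xpair_eqE.
have qE y : \sum_x pX x * t x y = q y.
  rewrite -flowE (maximizer_fixed_point y0 th01 pXd A0 Apos vch Sv vmax).
  rewrite (_ : \sum_d _ = 1) ?mulr1//.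
  under eq_bigr do rewrite flowE.
  rewrite exchange_big/= -[RHS]pXd.2; apply: eq_bigr => x _.
  have := pX0 x; rewrite le_eqVlt => /predU1P[<-|px].
    by rewrite big1// => y' _; rewrite mul0r.
  by rewrite -mulr_sumr (td _ px).2 mulr1.
(* At outputs of probability 0 the posterior is free; [pX] keeps it a distribution. The formula for
   [k] below results from solving p k = q r^(1/a) with t = p^a q^(1-a) / S. *)
pose r y x := if q y == 0 then pX x else pX x * t x y / q y.
pose k x := (pX x / S x) `^ a^-1.
have flow x y : 0 < q y -> q y * r y x = pX x * t x y.
  by move=> qy; rewrite /r gt_eqF// mulrC divfK// gt_eqF.
have t_gt0 x y : 0 < pX x -> 0 < p x y -> 0 < t x y.
  move=> px pxy; rewrite divr_gt0 ?Sv// mulr_gt0 ?powR_gt0//.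
  exact: q0 pxy.
have r0 x y : 0 < pX x -> 0 < p x y -> 0 < r y x.
  move=> px pxy; have qy := q0 _ _ px pxy.
  by rewrite -(pmulr_rgt0 _ qy) flow// mulr_gt0// t_gt0.
exists q, r, t, k; split=> //.
- exact: (vch tt).
- move=> y; rewrite /r; case: eqVneq => // qy; split=> [x|].
    rewrite divr_ge0 ?(vch tt).1//.
    have := pX0 x; rewrite le_eqVlt => /predU1P[<-|px]; first by rewrite mul0r.
    by rewrite mulr_ge0// (td _ px).1.
  by rewrite -mulr_suml qE mulfV.
- by move=> x px; rewrite powR_gt0// divr_gt0 ?Sv.
- by move=> x y px pxy; rewrite /t /tilted_channel /A pxy powR0 ?gt_eqF// !mul0r.
- by move=> x y px pxy; rewrite r0// (q0 x).
- by move=> x y px pxy; rewrite flow// (q0 x).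
- move=> x y px pxy; have qy := q0 _ _ px pxy; have Sx := Sv _ px.
  have -> : r y x = (k x * p x y / q y) `^ a.
    rewrite !powRM ?mulr_ge0 ?powR_ge0 ?invr_ge0 ?(ltW qy)//.
    rewrite -powRrM mulVf ?gt_eqF// powRr1 ?divr_ge0 ?(ltW Sx)//.
    rewrite -[_^-1 in X in _ = _ * X](powR_inv1 (ltW qy)) -powRrM mulN1r.
    rewrite /r gt_eqF// /t /tilted_channel -/(q y) -/(S x) /A.
    rewrite powRB ?gt_eqF ?implybT// powRr1 ?(ltW qy)// powRN.
    by field; rewrite !gt_eqF ?powR_gt0.
  rewrite -powRrM mulfV ?gt_eqF// powRr1; last first.
    by rewrite divr_ge0 ?mulr_ge0 ?powR_ge0 ?(ltW qy).
  by field; rewrite gt_eqF.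
Qed.

(** Here the maximizer is the reverse channel r, and q is defined as the output marginal of p_X t.
    The fixed point equation says that r is the posterior; dividing q r = p_X p r^(1-1/a) / S by
    r^(1-1/a) gives k = p_X / S. *)
Lemma exists_saddle_point_gt1 : 1 < a -> exists q r t k, saddle_point a pX p q r t k.
Proof.
move=> a1.
have [x0 _] := is_dist_gt0 pXd.
pose h (x : X) (y : Y) := (y, x).
have a'0 : 0 < a^-1 by rewrite invr_gt0.
have a'1 : a^-1 < 1 by rewrite invf_lt1.
have th01 : 0 < 1 - a^-1 < 1 by rewrite subr_gt0 a'1 gtrBl a'0.
have Apos x : 0 < pX x -> exists y, 0 < p x y by move=> _; exact: is_dist_gt0.
have [r [rch Sv] vmax] := exists_max_log_channel h x0 th01 pXd p0 Apos.
pose S := tilted_sum (1 - a^-1) p h r.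
pose t := tilted_channel (1 - a^-1) p h r.
have td x : 0 < pX x -> is_dist (t x).
  by move=> px; exact: (tilted_channel_is_dist p0 (Sv x px)).
have r0 x y : 0 < pX x -> 0 < p x y -> 0 < r y x.
  move=> px pxy.
  by have := maximizer_gt0 x0 th01 pXd p0 rch Sv vmax px pxy.
have flowE y x : tilted_flow (1 - a^-1) pX p h r y x = pX x * t x y.
  rewrite /tilted_flow (bigD1 x)//= (big_pred1 y) => [|y']; last first.
    by rewrite xpair_eqE eqxx andbT.
  rewrite big1 ?addr0// => x' /negbTE xx'; apply: big_pred0 => y'.
  by rewrite xpair_eqE xx' andbF.
pose q y := \sum_x pX x * t x y.
have tt0 x y : 0 <= pX x * t x y.
  have := pX0 x; rewrite le_eqVlt => /predU1P[<-|px]; first by rewrite mul0r.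
  by rewrite mulr_ge0// (td _ px).1.
have flow x y : q y * r y x = pX x * t x y.
  rewrite -flowE (maximizer_fixed_point x0 th01 pXd p0 Apos rch Sv vmax) mulrC.
  by congr (_ * _); apply: eq_bigr => d _; rewrite flowE.
have t_gt0 x y : 0 < pX x -> 0 < p x y -> 0 < t x y.
  by move=> px pxy; rewrite divr_gt0 ?Sv// mulr_gt0 ?powR_gt0// r0.
have q0 x y : 0 < pX x -> 0 < p x y -> 0 < q y.
  move=> px pxy; rewrite -(pmulr_lgt0 _ (r0 _ _ px pxy)) flow mulr_gt0//.
  exact: t_gt0.
exists q, r, t, (fun x => pX x / S x); split=> //.
- split=> [y|]; first exact: sumr_ge0.
  rewrite exchange_big/= -[RHS]pXd.2; apply: eq_bigr => x _.
  have := pX0 x; rewrite le_eqVlt => /predU1P[<-|px].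
    by rewrite big1// => y' _; rewrite mul0r.
  by rewrite -mulr_sumr (td _ px).2 mulr1.
- by move=> x px; rewrite divr_gt0 ?Sv.
- by move=> x y px pxy; rewrite /t /tilted_channel pxy !mul0r.
- by move=> x y px pxy; rewrite r0// (q0 x).
- move=> x y px pxy; have ry := r0 _ _ px pxy; have Sx := Sv _ px.
  have -> : r y x `^ a^-1 = r y x / r y x `^ (1 - a^-1).
    rewrite -[X in _ = X / _](powRr1 (ltW ry)) -powRB; last by rewrite (gt_eqF ry) implybT.
    by congr (_ `^ _); ring.
  rewrite [RHS]mulrA flow /t /tilted_channel -/(S x).
  by field; rewrite !gt_eqF ?powR_gt0.
Qed.

End Saddle.

(** * Duality *)

(** [epowR] is infinite only at base 0 with a negative exponent. A zero coefficient absorbs that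
    value, because 0 times +oo is 0. *)
Lemma sume_epowR (R : realType) (T : finType) (c w : T -> R) (e : R) :
  e != 0 -> (forall t, 0 <= c t) -> (e < 0 -> forall t, 0 < c t -> w t != 0) ->
  (\sum_t (c t)%:E * epowR (w t) e = (\sum_t c t * w t `^ e)%:E)%E.
Proof.
move=> e0 c0 cw; rewrite -sumEFin; apply: eq_bigr => t _.
have := c0 t; rewrite le_eqVlt => /predU1P[<-|ct]; first by rewrite mul0e mul0r.
rewrite /epowR; case: eqVneq => [wt|_]; last by rewrite EFinM.
rewrite (negbTE e0) wt powR0// mulr0.
by case: ifPn => [/cw/(_ _ ct)|_]; rewrite ?wt ?eqxx// mule0.
Qed.

Lemma sume_epowR_pinfty (R : realType) (T : finType) (c w : T -> R) (e : R) t :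
  e < 0 -> (forall t, 0 <= c t) -> 0 < c t -> w t = 0 ->
  (\sum_t (c t)%:E * epowR (w t) e = +oo)%E.
Proof.
move=> e0 c0 ct wt; apply/esum_eqyP => [s _|].
  rewrite /epowR; case: (eqVneq (w s) 0) => _; last by rewrite -EFinM.
  rewrite e0; have := c0 s; rewrite le_eqVlt => /predU1P[<-|cs].
    by rewrite mul0e.
  by rewrite gt0_muley.
by exists t; split; rewrite ?mem_index_enum// /epowR wt eqxx e0 gt0_muley.
Qed.

Lemma sume_EFin_mul_fin (R : realType) (T : finType) (c : T -> R)
    (f : T -> \bar R) (g : T -> R) :
  (forall t, 0 <= c t) -> (forall t, 0 < c t -> f t = (g t)%:E) ->
  (\sum_t (c t)%:E * f t = (\sum_t c t * g t)%:E)%E.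
Proof.
move=> c0 fg; rewrite -sumEFin; apply: eq_bigr => t _.
have := c0 t; rewrite le_eqVlt => /predU1P[<-|ct]; first by rewrite mul0e mul0r.
by rewrite fg// EFinM.
Qed.

(** Since -oo + +oo is -oo in [\bar R], the terms equal to -oo have to be excluded. *)
Lemma sume_EFin_mul_pinfty (R : realType) (T : finType) (c : T -> R)
    (f : T -> \bar R) t :
  (forall t, 0 <= c t) -> (forall t, 0 < c t -> f t != -oo%E) -> 0 < c t -> f t = +oo%E ->
  (\sum_t (c t)%:E * f t = +oo)%E.
Proof.
move=> c0 fN ct ft; apply/esum_eqyP => [s _|].
  have := c0 s; rewrite le_eqVlt => /predU1P[<-|cs]; first by rewrite mul0e.
  by have := fN s cs; case: (f s) => [x| |]//= _; rewrite gt0_muley.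
by exists t; split; rewrite ?mem_index_enum// ft gt0_muley.
Qed.

Lemma sume_EFin_mul_ninfty (R : realType) (T : finType) (c : T -> R)
    (f : T -> \bar R) t :
  0 < c t -> f t = -oo%E -> (\sum_t (c t)%:E * f t = -oo)%E.
Proof.
move=> ct ft; apply/esum_eqNyP.
by exists t; split; rewrite ?mem_index_enum// ft gt0_muleNy.
Qed.

(** S_x(q) for one row of the channel, with real powers; [gallager_sum] is T_x(r). *)
Definition renyi_sum {R : realType} {Y : finType} (a : R) (p q : Y -> R) : R :=
  \sum_y p y `^ a * q y `^ (1 - a).

Definition gallager_sum {R : realType} {Y : finType} (a : R) (p r : Y -> R) : R :=
  \sum_y p y * r y `^ (1 - a^-1).

Section RenyiTerms.
Context {R : realType} {Y : finType}.
Variables (a : R) (p : Y -> R).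
Hypothesis a0 : 0 < a.
Hypothesis a1 : a != 1.
Hypothesis pd : is_dist p.

Lemma renyi_sum_ge0 q : 0 <= renyi_sum a p q.
Proof. by apply: sumr_ge0 => y _; rewrite mulr_ge0 ?powR_ge0. Qed.

Lemma gallager_sum_ge0 r : 0 <= gallager_sum a p r.
Proof. by apply: sumr_ge0 => y _; rewrite mulr_ge0 ?powR_ge0// pd.1. Qed.

(* [powR 0 e = 0] even for e < 0, where the extended power is +oo, so the real
   sums above have the intended value only under these support conditions. *)
Definition renyi_finite q :=
  0 < renyi_sum a p q /\ (1 < a -> forall y, 0 < p y -> 0 < q y).

Definition gallager_finite r :=
  0 < gallager_sum a p r /\ (a < 1 -> forall y, 0 < p y -> 0 < r y).

Lemma epowR_pow (x : R) : epowR x a = (x `^ a)%:E.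
Proof.
rewrite /epowR; case: eqVneq => // ->.
by rewrite (lt_gtF a0) (gt_eqF a0) powR0 ?gt_eqF.
Qed.

Lemma renyi_fin q : (forall y, 0 <= q y) -> renyi_finite q ->
  renyi a p q = ((a - 1)^-1 * ln (renyi_sum a p q))%:E.
Proof.
move=> q0 [S0 supp]; rewrite /renyi; under eq_bigr do rewrite epowR_pow.
rewrite sume_epowR => [||y|a1' y]; rewrite ?powR_ge0//; last 2 first.
- by rewrite subr_eq0 eq_sym.
- move=> py; rewrite gt_eqF// supp//; first by rewrite subr_lt0 in a1'.
  by apply: (gt0_powR a0); rewrite ?pd.1.
by rewrite /eln gt_eqF// -EFinM.
Qed.

(** For a < 1 the sum is 0 and its logarithm -oo meets a negative factor; for a > 1 a zero of [q]
    under the support of [p] makes the sum infinite. *)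
Lemma renyi_pinfty q : (forall y, 0 <= q y) -> ~ renyi_finite q ->
  renyi a p q = +oo%E.
Proof.
move=> q0 nfin; rewrite /renyi; under eq_bigr do rewrite epowR_pow.
have [a1'|a1'|aE] := ltgtP a 1; last by move: a1; rewrite aE eqxx.
- rewrite sume_epowR => [||y|]; rewrite ?powR_ge0//; last 2 first.
  + by rewrite subr_eq0 eq_sym.
  + by rewrite subr_lt0 (lt_gtF a1').
  have S0 : renyi_sum a p q = 0.
    apply/eqP/negPn/negP => S0; apply: nfin; split.
      by rewrite lt0r S0 renyi_sum_ge0.
    by rewrite (lt_gtF a1').
  by rewrite -/(renyi_sum a p q) S0 /eln eqxx lt0_muleNy// lte_fin invr_lt0 subr_lt0.
- have [y [py qy]] : exists y, 0 < p y /\ q y = 0.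
    apply/not_existsP => H; apply: nfin.
    have supp y : 0 < p y -> 0 < q y.
      by move=> py; rewrite lt0r q0 andbT; apply/eqP => qy; exact: (H y).
    split=> //; have [y py] := is_dist_gt0 pd.
    apply: (sumr_gt0_witness (t := y)) => [t|]; first by rewrite mulr_ge0 ?powR_ge0.
    by rewrite mulr_gt0 ?powR_gt0// supp.
  rewrite (@sume_epowR_pinfty _ _ _ _ _ y) ?subr_lt0 ?powR_gt0//.
    by rewrite gt0_muley// lte_fin invr_gt0 subr_gt0.
  by move=> t; exact: powR_ge0.
Qed.

Let e1 : 1 - a^-1 != 0.
Proof. by rewrite subr_eq0 eq_sym invr_eq1. Qed.

Lemma gallager_fin r : (forall y, 0 <= r y) -> gallager_finite r ->
  eln (\sum_y (p y)%:E * epowR (r y) (1 - a^-1))%E = (ln (gallager_sum a p r))%:E.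
Proof.
move=> r0 [T0 supp]; rewrite sume_epowR => [|//|y|]; last 2 first.
- exact: pd.1.
- by rewrite subr_lt0 invf_gt1// => a1' y py; rewrite gt_eqF// supp.
by rewrite /eln gt_eqF.
Qed.

(** The sign of the infinity is opposite to that of a/(a-1), so [G_AC] becomes -oo in both
    regimes. *)
Lemma gallager_infty r : (forall y, 0 <= r y) -> ~ gallager_finite r ->
  eln (\sum_y (p y)%:E * epowR (r y) (1 - a^-1))%E =
  if a < 1 then +oo%E else -oo%E.
Proof.
move=> r0 nfin; case: ifPn => a1'.
- have [y [py ry]] : exists y, 0 < p y /\ r y = 0.
    apply/not_existsP => H; apply: nfin.
    have supp y : 0 < p y -> 0 < r y.
      by move=> py; rewrite lt0r r0 andbT; apply/eqP => ry; exact: (H y).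
    split=> //; have [y py] := is_dist_gt0 pd.
    apply: (sumr_gt0_witness (t := y)) => [t|]; first by rewrite mulr_ge0 ?powR_ge0// pd.1.
    by rewrite mulr_gt0 ?powR_gt0// supp.
  by rewrite (@sume_epowR_pinfty _ _ _ _ _ y) ?subr_lt0 ?invf_gt1//; exact: pd.1.
- rewrite sume_epowR => [|//|y|]; last 2 first.
  + exact: pd.1.
  + by rewrite subr_lt0 invf_gt1// (negbTE a1').
  have T0 : gallager_sum a p r = 0.
    apply/eqP/negPn/negP => T0; apply: nfin; split.
      by rewrite lt0r T0 gallager_sum_ge0.
    by rewrite (negbTE a1').
  by rewrite -/(gallager_sum a p r) T0 /eln eqxx.
Qed.

(** Hoelder's inequality in two arrangements. For a < 1, p^a q^(1-a) = (p r^(1-1/a))^a (q r)^(1-a),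
    and the negative factor 1/(a-1) reverses the inequality. For a > 1, p r^(1-1/a) = (p^a
    q^(1-a))^(1/a) (q r)^(1-1/a). The positivity claim is the support condition for Gibbs'
    inequality in [weak_duality_real]. *)
Lemma ln_gallager_le q r : is_dist q -> (forall y, 0 <= r y) ->
  renyi_finite q -> gallager_finite r ->
  0 < \sum_y q y * r y /\
  a / (a - 1) * ln (gallager_sum a p r) <=
    (a - 1)^-1 * ln (renyi_sum a p q) + ln (\sum_y q y * r y).
Proof.
move=> [q0 _] r0 [S0 supq] [T0 supr].
have v0 y : 0 <= q y * r y by rewrite mulr_ge0.
have exists_gt0 (f : Y -> R) : (forall y, 0 <= f y) -> 0 < \sum_y f y -> exists y, 0 < f y.
  move=> f0 sf; apply/not_existsP => H; move: sf; rewrite big1 ?ltxx// => y _.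
  by apply/eqP; rewrite eq_le f0 andbT leNgt; apply/negP/H.
have [a1'|a1'|aE] := ltgtP a 1; last by move: a1; rewrite aE eqxx.
- pose u y := p y * r y `^ (1 - a^-1).
  have zE y : p y `^ a * q y `^ (1 - a) = u y `^ a * (q y * r y) `^ (1 - a).
    have := pd.1 y; rewrite le_eqVlt => /predU1P[/esym py|py].
      by rewrite /u py mul0r powR0 ?gt_eqF// !mul0r.
    have ry := supr a1' _ py.
    rewrite /u !powRM ?powR_ge0 ?(ltW py)// -powRrM.
    have -> : (1 - a^-1) * a = - (1 - a) by field; rewrite gt_eqF.
    by rewrite powRN; field; rewrite gt_eqF// powR_gt0.
  have R0 : 0 < \sum_y q y * r y.
    have [|y] := exists_gt0 _ _ S0; first by move=> y; rewrite mulr_ge0 ?powR_ge0.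
    move=> zy; apply: (sumr_gt0_witness (t := y)) => //.
    rewrite lt0r v0 andbT; apply/eqP => vy; move: zy; rewrite zE vy.
    by rewrite [0 `^ _]powR0 ?mulr0 ?ltxx// subr_eq0 eq_sym.
  split=> //.
  have := @ln_holder R Y a u _ _ _ _ v0 zE S0.
  rewrite a0 a1' => /(_ isT); rewrite -/(renyi_sum a p q) -/(gallager_sum a p r).
  have u0 y : 0 <= u y by rewrite mulr_ge0 ?powR_ge0// pd.1.
  move=> /(_ u0) H.
  have := ler_wnM2l (_ : (a - 1)^-1 <= 0) H; rewrite invr_le0 subr_le0 (ltW a1').
  move=> /(_ isT); rewrite mulrDr.
  have -> : (a - 1)^-1 * ((1 - a) * ln (\sum_y q y * r y)) = - ln (\sum_y q y * r y).
    by field; rewrite subr_eq0.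
  by rewrite lerBlDr mulrA (mulrC _ a).
- pose u y := p y `^ a * q y `^ (1 - a).
  have a'0 : 0 < a^-1 by rewrite invr_gt0.
  have a'1 : a^-1 < 1 by rewrite invf_lt1.
  have zE y : p y * r y `^ (1 - a^-1) = u y `^ a^-1 * (q y * r y) `^ (1 - a^-1).
    have := pd.1 y; rewrite le_eqVlt => /predU1P[/esym py|py].
      by rewrite /u py powR0 ?gt_eqF// !mul0r powR0 ?gt_eqF// mul0r.
    have qy := supq a1' _ py.
    rewrite /u !powRM ?powR_ge0 ?(ltW py) ?(ltW qy)// -!powRrM mulfV ?gt_eqF//.
    rewrite (powRr1 (ltW py)).
    have -> : (1 - a) / a = - (1 - a^-1) by field; rewrite gt_eqF.
    by rewrite powRN; field; rewrite gt_eqF// powR_gt0.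
  have R0 : 0 < \sum_y q y * r y.
    have [|y] := exists_gt0 _ _ T0; first by move=> y; rewrite mulr_ge0 ?powR_ge0// pd.1.
    move=> zy; apply: (sumr_gt0_witness (t := y)) => //.
    rewrite lt0r v0 andbT; apply/eqP => vy; move: zy; rewrite zE vy.
    by rewrite [0 `^ _]powR0 ?mulr0 ?ltxx.
  split=> //.
  have := @ln_holder R Y a^-1 u _ _ _ _ v0 zE T0.
  rewrite a'0 a'1 => /(_ isT); rewrite -/(renyi_sum a p q) -/(gallager_sum a p r).
  have u0 y : 0 <= u y by rewrite mulr_ge0 ?powR_ge0.
  move=> /(_ u0) H.
  have := ler_wpM2l (_ : 0 <= a / (a - 1)) H.
  rewrite divr_ge0 ?subr_ge0 ?(ltW a1') ?(ltW a0)// => /(_ isT)/le_trans; apply.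
  by rewrite le_eqVlt; apply/orP; left; apply/eqP; field; rewrite subr_eq0 a1 gt_eqF.
Qed.

End RenyiTerms.

Section Duality.
Context {R : realType} {X Y : finType}.
Variables (a : R) (pX : X -> R) (p : X -> Y -> R).
Hypothesis a0 : 0 < a.
Hypothesis a1 : a != 1.
Hypothesis pXd : is_dist pX.
Hypothesis pch : is_channel p.

Let pX0 x : 0 <= pX x. Proof. exact: pXd.1. Qed.

Definition AC_finite q := forall x, 0 < pX x -> renyi_finite a (p x) q.
Definition G_finite (r : Y -> X -> R) :=
  forall x, 0 < pX x -> gallager_finite a (p x) (r^~ x).

Definition AC_real q := \sum_x pX x * ((a - 1)^-1 * ln (renyi_sum a (p x) q)).
Definition G_real (r : Y -> X -> R) :=
  a / (a - 1) * \sum_x pX x * ln (gallager_sum a (p x) (r^~ x)).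

Lemma AC_obj_fin q : is_dist q -> AC_finite q -> AC_obj a pX p q = (AC_real q)%:E.
Proof.
move=> qd fin; apply: sume_EFin_mul_fin => // x px.
by rewrite renyi_fin//; [exact: qd.1|exact: fin].
Qed.

Lemma AC_obj_pinfty q : is_dist q -> ~ AC_finite q -> AC_obj a pX p q = +oo%E.
Proof.
move=> qd nfin.
have [x [px nx]] : exists x, 0 < pX x /\ ~ renyi_finite a (p x) q.
  apply: contrapT => H; apply: nfin => x px; apply: contrapT => nx.
  by apply: H; exists x.
apply: (sume_EFin_mul_pinfty (t := x)) => //.
- move=> s _; have [fin|nf] := pselect (renyi_finite a (p s) q).
    by rewrite renyi_fin//; exact: qd.1.
  by rewrite renyi_pinfty//; exact: qd.1.
- by rewrite renyi_pinfty//; exact: qd.1.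
Qed.

Lemma G_AC_fin r : is_channel r -> G_finite r -> G_AC a pX p r = (G_real r)%:E.
Proof.
move=> rch fin; rewrite /G_AC /G_real [RHS]EFinM; congr (_ * _)%E.
apply: sume_EFin_mul_fin => // x px.
by rewrite (gallager_fin a0 a1 (pch x) _ (fin x px))// => y; exact: (rch y).1.
Qed.

Lemma G_AC_ninfty r : is_channel r -> ~ G_finite r -> G_AC a pX p r = -oo%E.
Proof.
move=> rch nfin.
have [x [px nx]] : exists x, 0 < pX x /\ ~ gallager_finite a (p x) (r^~ x).
  apply: contrapT => H; apply: nfin => x px; apply: contrapT => nx.
  by apply: H; exists x.
have r0 s y : 0 <= r y s by exact: (rch y).1.
have infx := gallager_infty a0 a1 (pch x) (r0 x) nx.
rewrite /G_AC; have [a1'|a1'|aE] := ltgtP a 1; last by move: a1; rewrite aE eqxx.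
- rewrite a1' in infx.
  rewrite (sume_EFin_mul_pinfty _ _ px infx)//.
    by rewrite lt0_muley// lte_fin pmulr_rlt0// invr_lt0 subr_lt0.
  move=> s _; have [fin|nf] := pselect (gallager_finite a (p s) (r^~ s)).
    by rewrite (gallager_fin a0 a1 (pch s) (r0 s) fin).
  by rewrite (gallager_infty a0 a1 (pch s) (r0 s) nf) a1'.
- rewrite (lt_gtF a1') in infx.
  rewrite (sume_EFin_mul_ninfty px infx).
  by rewrite gt0_muleNy// lte_fin divr_gt0// subr_gt0.
Qed.

Lemma entropyE (T : finType) (P : T -> R) : entropy P = - \sum_t P t * ln (P t).
Proof.
rewrite /entropy; congr (- _); apply: eq_bigr => t _.
by case: eqVneq => // ->; rewrite mul0r.
Qed.

Lemma weak_duality_real q r : is_dist q -> is_channel r ->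
  AC_finite q -> G_finite r -> entropy pX + G_real r <= AC_real q.
Proof.
move=> qd rch fq fr.
(* The input law obtained by passing [q] through the reverse channel; Gibbs' inequality compares it
   with [pX]. *)
pose V x := \sum_y q y * r y x.
have r0 x y : 0 <= r y x by exact: (rch y).1.
have V0 x : 0 <= V x by apply: sumr_ge0 => y _; rewrite mulr_ge0// qd.1.
have V1 : \sum_x V x = 1.
  rewrite exchange_big/= -[RHS]qd.2; apply: eq_bigr => y _.
  by rewrite -mulr_sumr (rch y).2 mulr1.
have key x (px : 0 < pX x) := ln_gallager_le a0 a1 (pch x) qd (r0 x) (fq x px) (fr x px).
have gibbs := log_sum_le pXd V0 (fun x px => (key x px).1).
rewrite V1 ln1 in gibbs.
rewrite entropyE /G_real /AC_real mulr_sumr -subr_ge0 opprD opprK.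
apply: (@le_trans _ _ (- \sum_x pX x * ln (V x / pX x))); first by rewrite oppr_ge0.
rewrite -!sumrN -!big_split/=; apply: ler_sum => x _.
have := pX0 x; rewrite le_eqVlt => /predU1P[<-|px].
  by rewrite !(mul0r, mulr0, oppr0, addr0).
have [Vx le] := key x px.
rewrite ln_div ?posrE//.
move: (ler_wpM2l (pX0 x) le).
rewrite -/(V x); lra.
Qed.

Lemma weak_duality q r : is_dist q -> is_channel r ->
  ((entropy pX)%:E + G_AC a pX p r <= AC_obj a pX p q)%E.
Proof.
move=> qd rch.
have [fq|nq] := pselect (AC_finite q); last by rewrite AC_obj_pinfty// leey.
have [fr|nr] := pselect (G_finite r); last by rewrite G_AC_ninfty// addeNy leNye.
by rewrite AC_obj_fin// G_AC_fin// -EFinD lee_fin weak_duality_real.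
Qed.

Section SaddlePoint.
Variables (q : Y -> R) (r : Y -> X -> R) (t : X -> Y -> R) (k : X -> R).
Hypothesis sp : saddle_point a pX p q r t k.

Let qd := saddle_q sp.
Let rch := saddle_r sp.
Let p0 x y : 0 <= p x y. Proof. exact: (pch x).1. Qed.

(** Write r^(1-1/a) as r / r^(1/a), then replace r by [saddle_flow] and r^(1/a) by [saddle_k_eq].
    Summing over y evaluates T_x(r). *)
Lemma saddle_gallager_term x y : 0 < pX x ->
  p x y * r y x `^ (1 - a^-1) = pX x / k x * t x y.
Proof.
move=> px; have := p0 x y; rewrite le_eqVlt => /predU1P[/esym pxy|pxy].
  by rewrite pxy mul0r (saddle_t0 sp px pxy) mulr0.
have [qy ry] := saddle_pos sp px pxy; have kx := saddle_k sp px.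
rewrite mulrAC -(saddle_flow sp px pxy) powRB ?(gt_eqF ry) ?implybT//.
rewrite (powRr1 (ltW ry)) mulrA.
have ra : 0 < r y x `^ a^-1 by exact: powR_gt0.
apply: (mulIf (lt0r_neq0 ra)); rewrite divfK ?gt_eqF//.
apply: (mulIf (lt0r_neq0 kx)); rewrite mulrAC (saddle_k_eq sp px pxy).
by field; rewrite gt_eqF.
Qed.

(** Solving [saddle_k_eq] for r gives r = (p k / q)^a, which is inserted into [saddle_flow]. *)
Lemma saddle_renyi_term x y : 0 < pX x ->
  p x y `^ a * q y `^ (1 - a) = pX x / k x `^ a * t x y.
Proof.
move=> px; have := p0 x y; rewrite le_eqVlt => /predU1P[/esym pxy|pxy].
  by rewrite pxy powR0 ?gt_eqF// mul0r (saddle_t0 sp px pxy) mulr0.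
have [qy ry] := saddle_pos sp px pxy; have kx := saddle_k sp px.
rewrite mulrAC -(saddle_flow sp px pxy) powRB ?(gt_eqF qy) ?implybT//.
rewrite (powRr1 (ltW qy)).
have -> : r y x = (p x y * k x / q y) `^ a.
  rewrite (saddle_k_eq sp px pxy) mulrAC mulfV ?gt_eqF// mul1r -powRrM mulVf ?gt_eqF//.
  by rewrite powRr1// ltW.
rewrite !powRM ?mulr_ge0 ?invr_ge0 ?(ltW kx) ?(ltW qy)//.
rewrite -[(q y)^-1](powR_inv1 (ltW qy)) -powRrM mulN1r powRN.
by field; rewrite !gt_eqF ?powR_gt0.
Qed.

Lemma saddle_gallager x : 0 < pX x -> gallager_sum a (p x) (r^~ x) = pX x / k x.
Proof.
move=> px; rewrite /gallager_sum; under eq_bigr do rewrite saddle_gallager_term//.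
by rewrite -mulr_sumr (saddle_t sp px).2 mulr1.
Qed.

Lemma saddle_renyi x : 0 < pX x -> renyi_sum a (p x) q = pX x / k x `^ a.
Proof.
move=> px; rewrite /renyi_sum; under eq_bigr do rewrite saddle_renyi_term//.
by rewrite -mulr_sumr (saddle_t sp px).2 mulr1.
Qed.

Lemma saddle_AC_finite : AC_finite q.
Proof.
move=> x px; have kx := saddle_k sp px; split.
  by rewrite saddle_renyi// divr_gt0// powR_gt0.
by move=> _ y pxy; have [] := saddle_pos sp px pxy.
Qed.

Lemma saddle_G_finite : G_finite r.
Proof.
move=> x px; have kx := saddle_k sp px; split.
  by rewrite saddle_gallager// divr_gt0.
by move=> _ y pxy; have [] := saddle_pos sp px pxy.
Qed.

Lemma saddle_value : entropy pX + G_real r = AC_real q.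
Proof.
rewrite entropyE /G_real /AC_real mulr_sumr -sumrN -big_split/=.
apply: eq_bigr => x _; have := pX0 x; rewrite le_eqVlt => /predU1P[<-|px].
  by rewrite !(mul0r, mulr0, oppr0, addr0).
have kx := saddle_k sp px.
rewrite saddle_gallager// saddle_renyi// !ln_div ?posrE ?powR_gt0// ln_powR.
by field; rewrite subr_eq0.
Qed.

(** The point [q] attains the value, and [r] certifies through weak duality that nothing smaller
    occurs. *)
Lemma saddle_I_AC : I_AC a pX p = (AC_real q)%:E.
Proof.
apply/eqP; rewrite eq_le; apply/andP; split.
  by apply: ereal_inf_lbound; exists q => //; exact: AC_obj_fin saddle_AC_finite.
apply: le_ereal_inf_tmp => _ [q' q'd <-]; rewrite -saddle_value EFinD.
by rewrite -(G_AC_fin rch saddle_G_finite); exact: weak_duality.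
Qed.

End SaddlePoint.
End Duality.

(** * Variational formulas *)

Lemma KL_fin (R : realType) (T : finType) (P Q : T -> R) :
  (forall t, P t != 0 -> Q t != 0) ->
  KL P Q = (\sum_t P t * ln (P t / Q t))%:E.
Proof.
move=> PQ; rewrite /KL -sumEFin; apply: eq_bigr => t _; rewrite /kl_term.
case: eqVneq => [->|Pt]; first by rewrite mul0r.
by rewrite (negbTE (PQ _ Pt)).
Qed.

Lemma KL_pinfty (R : realType) (T : finType) (P Q : T -> R) t :
  P t != 0 -> Q t = 0 -> KL P Q = +oo%E.
Proof.
move=> Pt Qt; apply/esum_eqyP => [s _|].
  by rewrite /kl_term; case: ifP => // _; case: ifP.
by exists t; split; rewrite ?mem_index_enum// /kl_term (negbTE Pt) Qt eqxx.
Qed.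

Lemma KL_neq_ninfty (R : realType) (T : finType) (P Q : T -> R) : KL P Q != -oo%E.
Proof.
apply/eqP => /esum_eqNyP[t [_ _]].
by rewrite /kl_term; case: ifP => // _; case: ifP.
Qed.

Section Variational.
Context {R : realType} {X Y : finType}.
Variables (a : R) (pX : X -> R) (p : X -> Y -> R).
Hypothesis a0 : 0 < a.
Hypothesis a1 : a != 1.
Hypothesis pXd : is_dist pX.
Hypothesis pch : is_channel p.

Let pX0 x : 0 <= pX x. Proof. exact: pXd.1. Qed.
Let p0 x y : 0 <= p x y. Proof. exact: (pch x).1. Qed.

Definition F_finite (qt : X -> Y -> R) (q : Y -> R) :=
  forall x y, 0 < pX x -> 0 < qt x y -> 0 < p x y /\ 0 < q y.

Definition F_tilde_finite (qt : X -> Y -> R) (r : Y -> X -> R) :=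
  forall x y, 0 < pX x -> 0 < qt x y -> 0 < p x y /\ 0 < r y x.

Lemma sum_joint (qt : X -> Y -> R) (g : X -> Y -> R) :
  \sum_(z : X * Y) joint pX qt z * g z.1 z.2 = \sum_x pX x * \sum_y qt x y * g x y.
Proof.
rewrite -(pair_bigA _ (fun x y => joint pX qt (x, y) * g x y))/=.
by apply: eq_bigr => x _; rewrite mulr_sumr; apply: eq_bigr => y _; rewrite mulrA.
Qed.

Lemma KL_joint_fin (qt W : X -> Y -> R) :
  (forall x y, 0 < pX x -> 0 < qt x y -> 0 < W x y) -> is_channel qt ->
  KL (joint pX qt) (joint pX W) =
    (\sum_x pX x * \sum_y qt x y * ln (qt x y / W x y))%:E.
Proof.
move=> qW qtch.
have pos z : joint pX qt z != 0 -> 0 < pX z.1 /\ 0 < qt z.1 z.2.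
  rewrite /joint mulf_eq0 negb_or => /andP[px qz].
  by rewrite !lt0r px qz pX0 (qtch z.1).1.
rewrite KL_fin => [|z /pos[px qz]]; last first.
  by rewrite /joint mulf_neq0// gt_eqF// qW.
congr EFin; rewrite -sum_joint; apply: eq_bigr => z _.
have [->|/pos[px qz]] := eqVneq (joint pX qt z) 0; first by rewrite !mul0r.
have Wz := qW _ _ px qz.
by congr (_ * ln _); rewrite /joint; field; rewrite !gt_eqF.
Qed.

(** Viewing the product law as a constant channel lets [KL_joint_fin] treat both divergences in
    [F_AC]. *)
Lemma prodd_joint q : prodd pX q = joint pX (fun (_ : X) (y : Y) => q y).
Proof. by []. Qed.

Lemma log_ratio_split (t u v e : R) : 0 < t -> 0 < u -> 0 < v ->
  t * ln (u `^ e * v `^ (1 - e) / t) =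
  - (e * (t * ln (t / u))) - (1 - e) * (t * ln (t / v)).
Proof.
move=> t0 u0 v0.
rewrite !ln_div ?posrE ?mulr_gt0 ?powR_gt0// lnM ?posrE ?powR_gt0// !ln_powR.
by ring.
Qed.

(** Both divergences merge into one log-ratio against p^a q^(1-a), the form to which the log-sum
    inequality applies row by row. *)
Lemma F_AC_fin qt q : is_channel qt -> F_finite qt q ->
  F_AC a pX p qt q = (\sum_x pX x * ((a - 1)^-1 *
    \sum_y qt x y * ln (p x y `^ a * q y `^ (1 - a) / qt x y)))%:E.
Proof.
move=> qtch fin; rewrite /F_AC prodd_joint !KL_joint_fin//; last 2 first.
- by move=> x y px qxy; have [] := fin x y px qxy.
- by move=> x y px qxy; have [] := fin x y px qxy.
rewrite -EFinM -EFinD; congr EFin.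
rewrite mulr_sumr -big_split/=; apply: eq_bigr => x _.
rewrite mulrCA -mulrDr.
have := pX0 x; rewrite le_eqVlt => /predU1P[<-|px]; first by rewrite !mul0r.
congr (_ * _); rewrite !mulr_sumr -big_split/=; apply: eq_bigr => y _.
have := (qtch x).1 y; rewrite le_eqVlt => /predU1P[<-|qxy].
  by rewrite !mul0r !mulr0 addr0.
have [pxy qy] := fin x y px qxy; rewrite log_ratio_split//.
by field; rewrite subr_eq0 a1 subr_eq0 eq_sym a1.
Qed.

(** For a < 1 the coefficient a/(1-a) is positive, so neither divergence term can be -oo and an
    infinite one decides the sum. *)
Lemma F_AC_pinfty qt q : a < 1 -> is_channel qt -> is_dist q -> ~ F_finite qt q ->
  F_AC a pX p qt q = +oo%E.
Proof.
move=> a1' qtch qd nfin.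
have [x [y [px qxy npq]]] : exists x y, [/\ 0 < pX x, 0 < qt x y &
    ~ (0 < p x y /\ 0 < q y)].
  apply: contrapT => H; apply: nfin => x y px qxy; apply: contrapT => n.
  by apply: H; exists x, y.
have Jz : joint pX qt (x, y) != 0 by rewrite mulf_neq0// gt_eqF.
have c0 : 0 < a / (1 - a) by rewrite divr_gt0// subr_gt0.
have KN (P Q : X * Y -> R) : ((a / (1 - a))%:E * KL P Q != -oo)%E.
  by have := KL_neq_ninfty P Q; case: (KL P Q) => [s| |]// _; rewrite gt0_muley.
rewrite /F_AC.
have [pxy|pxy] := eqVneq (p x y) 0.
  rewrite (@KL_pinfty _ _ (joint pX qt) (joint pX p) (x, y))//.
    by rewrite gt0_muley// addye// KL_neq_ninfty.
  by rewrite /joint/= pxy mulr0.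
have qy : q y = 0.
  apply/eqP/negPn/negP => qy; apply: npq.
  by rewrite !lt0r pxy qy p0 qd.1.
rewrite (@KL_pinfty _ _ (joint pX qt) (prodd pX q) (x, y))//; last first.
  by rewrite /prodd/= qy mulr0.
by rewrite addey.
Qed.

Lemma AC_le_F_AC qt q : a < 1 -> is_channel qt -> is_dist q ->
  (AC_obj a pX p q <= F_AC a pX p qt q)%E.
Proof.
move=> a1' qtch qd.
have [fin|nfin] := pselect (F_finite qt q); last by rewrite F_AC_pinfty// leey.
have zpos x y : 0 < pX x -> 0 < qt x y -> 0 < p x y `^ a * q y `^ (1 - a).
  by move=> px qxy; have [pxy qy] := fin x y px qxy; rewrite mulr_gt0 ?powR_gt0.
have ACfin : AC_finite a pX p q.
  move=> x px; split; last by rewrite (lt_gtF a1').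
  have [y qxy] := is_dist_gt0 (qtch x).
  apply: (sumr_gt0_witness (t := y)) => [t|]; first by rewrite mulr_ge0 ?powR_ge0.
  exact: zpos.
rewrite (AC_obj_fin a0 a1 pXd pch qd ACfin) F_AC_fin// lee_fin.
apply: ler_sum => x _; have := pX0 x.
rewrite le_eqVlt => /predU1P[<-|px]; first by rewrite !mul0r.
apply: ler_wpM2l => //; rewrite ler_wnM2l ?invr_le0 ?subr_le0 ?(ltW a1')//.
apply: log_sum_le => // [y|y]; first by rewrite mulr_ge0 ?powR_ge0.
exact: zpos.
Qed.

(** As a/(a-1) times 1 - 1/a is 1, the factor ln r is absorbed into the log-ratio; the remaining -
    ln p_X does not depend on y and averages to the entropy. *)
Lemma F_AC_tilde_fin qt r : is_channel qt -> is_channel r -> F_tilde_finite qt r ->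
  F_AC_tilde a pX p qt r = (entropy pX + \sum_x pX x * (a / (a - 1) *
    \sum_y qt x y * ln (p x y * r y x `^ (1 - a^-1) / qt x y)))%:E.
Proof.
move=> qtch rch fin; rewrite /F_AC_tilde KL_joint_fin//; last first.
  by move=> x y px qxy; have [] := fin x y px qxy.
have -> : (\sum_(z : X * Y) (joint pX qt z)%:E * eln (r z.2 z.1 / pX z.1)%:E =
    (\sum_x pX x * \sum_y qt x y * ln (r y x / pX x))%:E)%E.
  rewrite -(sum_joint qt (fun x y => ln (r y x / pX x))).
  apply: sume_EFin_mul_fin => [z|z Jz]; first by rewrite mulr_ge0// (qtch _).1.
  have [px qz] : 0 < pX z.1 /\ 0 < qt z.1 z.2.
    by move: Jz; rewrite /joint !lt0r mulf_eq0 negb_or pX0 (qtch z.1).1 => /andP[/andP[-> ->]].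
  have [_ rz] := fin _ _ px qz.
  by rewrite /eln gt_eqF// divr_gt0.
rewrite -EFinM -EFinD; congr EFin.
rewrite entropyE -sumrN mulr_sumr -!big_split/=; apply: eq_bigr => x _.
have := pX0 x; rewrite le_eqVlt => /predU1P[<-|px].
  by rewrite !(mul0r, mulr0, oppr0, addr0).
rewrite mulrCA -mulrN -!mulrDr; congr (_ * _).
have lnE : ln (pX x) = \sum_y qt x y * ln (pX x).
  by rewrite -mulr_suml (qtch x).2 mul1r.
rewrite [X in _ = - X + _]lnE !mulr_sumr -sumrN -!big_split/=.
apply: eq_bigr => y _.
have := (qtch x).1 y; rewrite le_eqVlt => /predU1P[<-|qxy].
  by rewrite !(mul0r, mulr0, oppr0, addr0).
have [pxy ry] := fin x y px qxy.
rewrite !ln_div ?posrE ?mulr_gt0 ?powR_gt0// lnM ?posrE ?powR_gt0// ln_powR.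
by field; rewrite ?subr_eq0 ?a1 ?[1 == a]eq_sym ?a1 ?gt_eqF.
Qed.

Lemma F_AC_tilde_ninfty qt r : 1 < a -> is_channel qt -> is_channel r ->
  ~ F_tilde_finite qt r -> F_AC_tilde a pX p qt r = -oo%E.
Proof.
move=> a1' qtch rch nfin.
have [x [y [px qxy npr]]] : exists x y, [/\ 0 < pX x, 0 < qt x y &
    ~ (0 < p x y /\ 0 < r y x)].
  apply: contrapT => H; apply: nfin => x y px qxy; apply: contrapT => n.
  by apply: H; exists x, y.
have Jz : 0 < joint pX qt (x, y) by rewrite mulr_gt0.
rewrite /F_AC_tilde.
have [pxy|pxy] := eqVneq (p x y) 0.
  rewrite (@KL_pinfty _ _ (joint pX qt) (joint pX p) (x, y)) ?gt_eqF//.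
    by rewrite lt0_muley ?addNye// lte_fin pmulr_rlt0// invr_lt0 subr_lt0.
  by rewrite /joint/= pxy mulr0.
have ry : r y x = 0.
  apply/eqP/negPn/negP => ry; apply: npr.
  by rewrite !lt0r pxy ry p0 (rch y).1.
rewrite (sume_EFin_mul_ninfty Jz) ?addeNy//=.
by rewrite ry mul0r eqxx.
Qed.

Lemma F_AC_tilde_le qt r : 1 < a -> is_channel qt -> is_channel r ->
  (F_AC_tilde a pX p qt r <= (entropy pX)%:E + G_AC a pX p r)%E.
Proof.
move=> a1' qtch rch.
have [fin|nfin] := pselect (F_tilde_finite qt r); last by rewrite F_AC_tilde_ninfty// leNye.
have zpos x y : 0 < pX x -> 0 < qt x y -> 0 < p x y * r y x `^ (1 - a^-1).
  by move=> px qxy; have [pxy qy] := fin x y px qxy; rewrite mulr_gt0 ?powR_gt0.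
have Gfin : G_finite a pX p r.
  move=> x px; split; last by rewrite (lt_gtF a1').
  have [y qxy] := is_dist_gt0 (qtch x).
  apply: (sumr_gt0_witness (t := y)) => [t|]; first by rewrite mulr_ge0 ?powR_ge0.
  exact: zpos.
rewrite (G_AC_fin a0 a1 pXd pch rch Gfin) F_AC_tilde_fin// -EFinD lee_fin lerD2l.
rewrite /G_real mulr_sumr; apply: ler_sum => x _; rewrite [leRHS]mulrCA.
have := pX0 x; rewrite le_eqVlt => /predU1P[<-|px]; first by rewrite !mul0r.
apply: ler_wpM2l => //; rewrite ler_wpM2l//.
  by rewrite divr_ge0 ?subr_ge0 ?ltW.
apply: log_sum_le => // [y|y]; first by rewrite mulr_ge0 ?powR_ge0.
exact: zpos.
Qed.

Section Attained.
Variables (q : Y -> R) (r : Y -> X -> R) (t : X -> Y -> R) (k : X -> R).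
Hypothesis sp : saddle_point a pX p q r t k.

(** [t] is known to be a distribution only at inputs of positive probability; elsewhere the row of
    [p] completes it to a channel. *)
Definition saddle_channel x y := if 0 < pX x then t x y else p x y.

Lemma saddle_channel_is_channel : is_channel saddle_channel.
Proof.
move=> x; rewrite /saddle_channel; have [px|_] := ltP 0 (pX x); last exact: pch.
exact: (saddle_t sp).
Qed.

Lemma saddle_channel_pos x y : 0 < pX x -> 0 < saddle_channel x y -> 0 < p x y.
Proof.
move=> px; rewrite /saddle_channel px => txy; rewrite lt0r p0 andbT.
by apply/eqP => pxy; move: txy; rewrite (saddle_t0 sp px pxy) ltxx.
Qed.

(** By [saddle_renyi_term], [t] is the normalization of p^a q^(1-a), which is the equality case of
    the log-sum inequality. *)
Lemma saddle_F_AC : F_AC a pX p saddle_channel q = (AC_real a pX p q)%:E.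
Proof.
have ch := saddle_channel_is_channel.
rewrite F_AC_fin// => [|x y px txy]; last first.
  have pxy := saddle_channel_pos px txy; split=> //.
  by have [] := saddle_pos sp px pxy.
congr EFin; apply: eq_bigr => x _.
have := pX0 x; rewrite le_eqVlt => /predU1P[<-|px]; first by rewrite !mul0r.
have S0 := (saddle_AC_finite a0 pch sp px).1.
congr (_ * (_ * _)); apply: log_sum_eq => // y.
rewrite /saddle_channel px (saddle_renyi_term a0 pch sp)// (saddle_renyi a0 pch sp px).
have kx := saddle_k sp px.
by rewrite mulrC mulKf// mulf_neq0 ?invr_neq0 ?gt_eqF ?powR_gt0.
Qed.

Lemma saddle_F_AC_tilde :
  F_AC_tilde a pX p saddle_channel r = (entropy pX + G_real a pX p r)%:E.
Proof.
have ch := saddle_channel_is_channel.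
rewrite F_AC_tilde_fin// => [||x y px txy]; last 2 first.
- exact: (saddle_r sp).
- have pxy := saddle_channel_pos px txy; split=> //.
  by have [] := saddle_pos sp px pxy.
congr (_ + _)%:E; rewrite /G_real mulr_sumr; apply: eq_bigr => x _; rewrite [RHS]mulrCA.
have := pX0 x; rewrite le_eqVlt => /predU1P[<-|px]; first by rewrite !mul0r.
have T0 := (saddle_G_finite pch sp px).1.
congr (_ * (_ * _)); apply: log_sum_eq => // y.
rewrite /saddle_channel px (saddle_gallager_term pch sp)// (saddle_gallager pch sp px).
have kx := saddle_k sp px.
by rewrite mulrC mulKf// mulf_neq0 ?invr_neq0 ?gt_eqF.
Qed.

End Attained.
End Variational.

Local Open Scope ereal_scope.

Theorem theorem2 (R : realType) (X Y : finType) (a : R)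
  (pX : X -> R) (pYX : X -> Y -> R) :
  (0 < a)%R -> a != 1%R ->
  is_dist pX -> is_channel pYX ->
  ((a < 1)%R ->
     is_minimum (fun qq : (X -> Y -> R) * (Y -> R) =>
                   is_channel qq.1 /\ is_dist qq.2)
                (fun qq => F_AC a pX pYX qq.1 qq.2)
                (I_AC a pX pYX)) /\
  ((1 < a)%R ->
     is_maximum (fun qr : (X -> Y -> R) * (Y -> X -> R) =>
                   is_channel qr.1 /\ is_channel qr.2)
                (fun qr => F_AC_tilde a pX pYX qr.1 qr.2)
                (I_AC a pX pYX)) /\
  is_maximum (fun r : Y -> X -> R => is_channel r)
             (fun r => (entropy pX)%:E + G_AC a pX pYX r)
             (I_AC a pX pYX).
Proof.
move=> a0 a1 pXd pch.
have [q [r [t [k sp]]]] : exists q r t k, saddle_point a pX pYX q r t k.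
  have [a1'|a1'|aE] := ltgtP a 1%R; last by rewrite aE eqxx in a1.
    exact: exists_saddle_point_lt1.
  exact: exists_saddle_point_gt1.
have IE := saddle_I_AC a0 a1 pXd pch sp.
have vE := saddle_value a0 a1 pXd pch sp.
have [qd rch] := (saddle_q sp, saddle_r sp).
have ch := saddle_channel_is_channel pch sp.
(* The infimum is attained at [q], so weak duality against this single point bounds every reverse
   channel. *)
have G_le r' : is_channel r' -> (entropy pX)%:E + G_AC a pX pYX r' <= I_AC a pX pYX.
  move=> r'ch; rewrite IE -(AC_obj_fin a0 a1 pXd pch qd (saddle_AC_finite a0 pch sp)).
  exact: weak_duality.
split; last split.
- move=> a1'; split.
    exists (saddle_channel pX pYX t, q); split=> //=.
    by rewrite IE; exact: saddle_F_AC sp.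
  move=> [qt q'] /= [qtch q'd]; apply: le_trans (AC_le_F_AC a0 a1 pXd pch a1' qtch q'd).
  by apply: ereal_inf_lbound; exists q'.
- move=> a1'; split.
    exists (saddle_channel pX pYX t, r); split=> //=.
    by rewrite IE -vE; exact: saddle_F_AC_tilde sp.
  move=> [qt r'] /= [qtch r'ch].
  by apply: le_trans (F_AC_tilde_le a0 a1 pXd pch a1' qtch r'ch) _; exact: G_le.
- split; last exact: G_le.
  exists r; split=> //.
  by rewrite IE -vE (G_AC_fin a0 a1 pXd pch rch (saddle_G_finite pch sp)) EFinD.
Qed.
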